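(* Let $\mathcal{L}=\{H_i\}_{i\in I}$ and $\mathcal{E}=\{E_j\}_{j\in J}$ be partitions of $\Omega$ ($I,J$ arbitrary), let $\mathcal{A}_{\mathcal L},\mathcal{A}_{\mathcal E},\mathcal{A}$ be Boolean algebras with $\langle\mathcal L\rangle\subseteq\mathcal A_{\mathcal L}\subseteq\langle\mathcal L\rangle^*$, $\langle\mathcal E\rangle\subseteq\mathcal A_{\mathcal E}\subseteq\langle\mathcal E\rangle^*$, $\langle\mathcal A_{\mathcal L}\cup\mathcal A_{\mathcal E}\rangle\subseteq\mathcal A\subseteq\langle\mathcal A_{\mathcal L}\cup\mathcal A_{\mathcal E}\rangle^*$. Let $\sigma$ be a strategy on $\mathcal A\times\mathcal L$ and $\pi$ a finitely additive probability on $\mathcal A_{\mathcal L}$. Then the set $\mathcal Q^{\mathbf{fsc}}$ of all fully strongly $\mathcal L$-conglomerable full conditional probabilities on $\mathcal A$ extending $\{\pi,\sigma\}$ is a non-empty compact subset of $[0,1]^{\mathcal A\times\mathcal A^0}$ endowed with the product topology of pointwise convergence.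
   Context: Events are elements of a Boolean algebra with operations $\wedge,\vee,(\cdot)^c$, implication order $\subseteq$, top $\Omega$ and bottom $\emptyset$; $\mathcal A^0=\mathcal A\setminus\{\emptyset\}$, $\mathcal A_{\mathcal L}^0=\mathcal A_{\mathcal L}\setminus\{\emptyset\}$. For a set $\mathcal G$ of events, $\langle\mathcal G\rangle$ is the Boolean algebra generated by $\mathcal G$, and $\langle\mathcal G\rangle^*$ is the complete atomic Boolean algebra generated by $\mathcal G$ (the minimal atomic Boolean algebra containing $\mathcal G$ and closed under arbitrary conjunctions and disjunctions). A partition of $\Omega$ is a family of pairwise incompatible non-impossible events with disjunction $\Omega$. The atoms of $\mathcal A$ are the events $H_i\wedge E_j\neq\emptyset$. A conditional event $E|H$ is a pair of events $(E,H)$ with $H\neq\emptyset$. Strategy: a map $\sigma:\mathcal A\times\mathcal L\to[0,1]$ such that for every $H_i\in\mathcal L$: (S1) $\sigma(F|H_i)=1$ for every $F\in\mathcal A$ with $F\wedge H_i=H_i$; (S2) $\sigma(\cdot|H_i)$ is a finitely additive probability on $\mathcal A$. Full conditional probability (f.c.p.) on $\mathcal A$: a function $P:\mathcal A\times\mathcal A^0\to[0,1]$ with (C1) $P(E|H)=P(E\wedge H|H)$; (C2) $P(\cdot|H)$ is a finitely additive probability on $\mathcal A$ for every $H\in\mathcal A^0$; (C3) $P(E\wedge F|H)=P(E|H)\,P(F|E\wedge H)$ whenever $H,E\wedge H\in\mathcal A^0$, $E,F\in\mathcal A$. It extends $\{\pi,\sigma\}$ if $P(B|\Omega)=\pi(B)$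 for $B\in\mathcal A_{\mathcal L}$ and $P(F|H_i)=\sigma(F|H_i)$ for $F\in\mathcal A$, $H_i\in\mathcal L$. Full strong $\mathcal L$-conglomerability: an f.c.p. $\tilde Q$ on $\mathcal A$ extending $\{\pi,\sigma\}$ is fully strongly $\mathcal L$-conglomerable if, with $\tilde\pi^{\mathbf p}=\tilde Q|_{\mathcal A_{\mathcal L}\times\mathcal A_{\mathcal L}^0}$, for every $F|K\in\mathcal A\times\mathcal A_{\mathcal L}^0$ and every $B\in\mathcal A_{\mathcal L}$ with $B\subseteq K$, $$\tilde\pi^{\mathbf p}(B|K)\inf_{H_i\subseteq B}\sigma(F|H_i)\le\tilde Q(F\wedge B|K)\le\tilde\pi^{\mathbf p}(B|K)\sup_{H_i\subseteq B}\sigma(F|H_i)$$ (for $B=\emptyset$ all three terms are understood as $0$). *)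

(* Defs.v *)
From HB Require Import structures.
From mathcomp Require Import all_boot all_order all_algebra.
From mathcomp Require Import all_classical all_reals all_analysis.

Set Implicit Arguments.
Unset Strict Implicit.
Unset Printing Implicit Defensive.

Import Order.TTheory GRing.Theory Num.Theory.
Import numFieldNormedType.Exports.

Local Open Scope classical_set_scope.
Local Open Scope ring_scope.

Section Events.
Context {d : Order.disp_t} {T : ctbDistrLatticeType d}.
Implicit Types (A AL C G : set T) (E F K : T).

Definition boolean_subalgebra A : Prop :=
  [/\ A \bot%O, A \top%O,
      forall E F, A E -> A F -> A (E `&` F)%O,
      forall E F, A E -> A F -> A (E `|` F)%O
    & forall E, A E -> A (~` E)%O].

Definition generated_algebra G : set T := smallest boolean_subalgebra G.

Definition atom_of C E : Prop :=
  [/\ C E, E <> \bot%O & forall F, C F -> (F <= E)%O -> F = \bot%O \/ F = E].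

(* Infinite conjunctions and disjunctions are those of the ambient algebra [T],
   which is not assumed to be complete. *)
Definition complete_atomic_subalgebra C : Prop :=
  [/\ boolean_subalgebra C,
      forall S : set T, S `<=` C -> exists2 E, supremums S E & C E,
      forall S : set T, S `<=` C -> exists2 E, infimums S E & C E
    & forall E, C E -> E <> \bot%O -> exists2 F, atom_of C F & (F <= E)%O].

Definition least_complete_atomic G C : Prop :=
  [/\ complete_atomic_subalgebra C, G `<=` C
    & forall C', complete_atomic_subalgebra C' -> G `<=` C' -> C `<=` C'].

(* When the ambient algebra has no least complete atomic subalgebra containing
   [G], this set is empty, so that no algebra is included in it. *)
Definition generated_complete_atomic G : set T :=
  [set E | exists2 C, least_complete_atomic G C & C E].

Definition is_partition (I : Type) (H : I -> T) : Prop :=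
  [/\ forall i, H i <> \bot%O,
      forall i j, i <> j -> (H i `&` H j)%O = \bot%O
    & supremums (range H) \top%O].

Definition nonimpossible A : set T := A `\ \bot%O.

Section Probability.
Context {R : realType}.

Definition fa_probability A (mu : T -> R) : Prop :=
  [/\ forall E, A E -> 0 <= mu E,
      mu \top%O = 1
    & forall E F, A E -> A F -> (E `&` F)%O = \bot%O ->
        mu (E `|` F)%O = mu E + mu F].

(* Conditional functions are written [P E K] for P(E|K); only their values on
   the stated domain are constrained. *)
Definition strategy A (I : Type) (H : I -> T) (sigma : T -> T -> R) : Prop :=
  [/\ forall F i, A F -> 0 <= sigma F (H i) <= 1,
      forall i F, A F -> (F `&` H i)%O = H i -> sigma F (H i) = 1
    & forall i, fa_probability A (fun F => sigma F (H i))].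

Definition full_conditional_probability A (P : T -> T -> R) : Prop :=
  [/\ forall E K, A E -> nonimpossible A K -> 0 <= P E K <= 1,
      forall E K, A E -> nonimpossible A K -> P E K = P (E `&` K)%O K,
      forall K, nonimpossible A K -> fa_probability A (fun E => P E K)
    & forall E F K, A E -> A F -> nonimpossible A K ->
        nonimpossible A (E `&` K)%O ->
        P (E `&` F)%O K = P E K * P F (E `&` K)%O].

Definition extends_prior_strategy A AL (I : Type) (H : I -> T)
    (pi : T -> R) (sigma : T -> T -> R) (P : T -> T -> R) : Prop :=
  (forall E, AL E -> P E \top%O = pi E) /\
  (forall F i, A F -> P F (H i) = sigma F (H i)).

(* For [E = \bot] the index set is empty and [inf set0 = sup set0 = 0], so the
   three terms are [0]. *)
Definition fully_strongly_conglomerable A AL (I : Type) (H : I -> T)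
    (sigma : T -> T -> R) (Q : T -> T -> R) : Prop :=
  forall F K E, A F -> nonimpossible AL K -> AL E -> (E <= K)%O ->
    Q E K * inf [set sigma F (H i) | i in [set i | (H i <= E)%O]]
      <= Q (F `&` E)%O K
      <= Q E K * sup [set sigma F (H i) | i in [set i | (H i <= E)%O]].

(* [set_type] carries the subspace topology and {ptws _ -> _} the topology of
   pointwise convergence, so this is a subset of the space [0,1]^(A x A^0). A point of that space is
   described by a total function agreeing with it on A x A^0; when AL is
   included in A and contains the events [H i], and A is a subalgebra, the
   conditions on [Q] involve only its values there. *)
Definition Qfsc A AL (I : Type) (H : I -> T) (pi : T -> R)
    (sigma : T -> T -> R) :
    set {ptws (set_type A * set_type (nonimpossible A))%type
              -> set_type (`[0, 1]%classic : set R)} :=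
  [set f | exists Q : T -> T -> R,
    [/\ forall (E : set_type A) (K : set_type (nonimpossible A)),
          set_val (f (E, K)) = Q (set_val E) (set_val K),
        full_conditional_probability A Q,
        extends_prior_strategy A AL H pi sigma Q
      & fully_strongly_conglomerable A AL H sigma Q]].

End Probability.
End Events.

Arguments Qfsc {d T R} A AL {I} H pi sigma.

(* Main.v *)
(* Every condition defining Q^fsc only involves finitely many values of the
   conditional probability, through continuous functions, so Q^fsc is closed in
   the space [0,1]^(A x A^0), which is compact by Tychonoff's theorem.

   For a nonempty Q^fsc, compactness of [0,1]^A first yields a finitely
   additive probability mu on A with
     pi(D) inf_{H_i <= D} sigma(F|H_i) <= mu(F /\ D)
       <= pi(D) sup_{H_i <= D} sigma(F|H_i)
   for all F in A and D in A_L: for finitely many events D take a mixture of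
   measures sigma(.|H_i), one for each nonempty block of the partition generated
   by these events, weighted by the prior probabilities of the blocks.
   Then condition on the first measure charging the conditioning event in the
   well-ordered list: mu, the sigma(.|H_i), the point masses at the atoms of the
   complete atomic algebra containing A. On A_L^0 only the first two layers
   matter, since sigma(K|H_i) = 1 as soon as H_i implies K in A_L. *)
Require Import Defs.
From HB Require Import structures.
From mathcomp Require Import all_boot all_order all_algebra.
From mathcomp Require Import all_classical all_reals all_analysis.
From mathcomp Require Import ring lra.

Import Order.Theory GRing.Theory Num.Theory.
Import numFieldNormedType.Exports.

Local Open Scope classical_set_scope.
Local Open Scope ring_scope.

Set Implicit Arguments.
Unset Strict Implicit.

(** * Partitions and the algebras they generate *)

Lemma sub_generated_algebra {d : Order.disp_t} {T : ctbDistrLatticeType d}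
    (G : set T) :
  G `<=` generated_algebra G.
Proof. by move=> x Gx C [_]; apply. Qed.

(** Otherwise the complement of [B] would be an upper bound of the partition, hence the top
    element. *)
Lemma partition_meet {d : Order.disp_t} {T : ctbDistrLatticeType d} {I : Type}
    (H : I -> T) (B : T) :
  is_partition H -> B <> \bot%O -> exists i, (H i `&` B)%O <> \bot%O.
Proof.
move=> [_ _ [_ lubH]] B0; apply: contrapT => /forallNP HB; apply: B0.
suff : (\top <= ~` B)%O by rewrite -disj_leC meet1x => /eqP.
apply: lubH => _ [i _ <-]; rewrite -disj_leC.
by apply/eqP; apply: contrapT; exact: HB.
Qed.

(** The events of [C] that every [H i] either implies or excludes form a complete atomic subalgebra
    containing the partition, so by minimality of [C] they exhaust it. *)
Lemma partition_generated_atom {d : Order.disp_t} {T : ctbDistrLatticeType d}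
    {I : Type} (H : I -> T) (B : T) (i : I) :
  is_partition H -> generated_complete_atomic (range H) B ->
  (H i <= B)%O \/ (H i `&` B)%O = \bot%O.
Proof.
move=> pH [C [[[Cbot Ctop CI CU CC] Csup Cinf Catom] HC minC] CB].
pose D := [set B | C B /\ forall i, (H i <= B)%O \/ (H i `&` B)%O = \bot%O].
suff DC : C `<=` D by have [_ /(_ i)] := DC _ CB.
have compl_case j x : (H j `&` x)%O = \bot%O <-> (H j <= ~` x)%O.
  by rewrite -disj_leC; split => /eqP.
apply: minC; last first.
  move=> _ [j _ <-]; split; first by apply: HC; exists j.
  move=> k; have [->|kj] := pselect (k = j); first by left.
  by right; case: pH => _ dH _; apply: dH.
have DS (S : set T) : S `<=` D -> S `<=` C by move=> SD x /SD[].
split.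
- split.
  + by split => // j; right; rewrite meetx0.
  + by split => // j; left; rewrite lex1.
  + move=> x y [Cx Hx] [Cy Hy]; split; first exact: CI.
    move=> j; case: (Hx j) => [jx|jx]; last by right; rewrite meetA jx meet0x.
    case: (Hy j) => [jy|jy]; last by right; rewrite meetCA jy meetx0.
    by left; rewrite lexI jx jy.
  + move=> x y [Cx Hx] [Cy Hy]; split; first exact: CU.
    move=> j; case: (Hx j) => [jx|jx]; first by left; rewrite lexU2 ?jx.
    case: (Hy j) => [jy|jy]; first by left; rewrite lexU2 ?jy ?orbT.
    by right; rewrite meetUr jx jy joinx0.
  + move=> x [Cx Hx]; split; first exact: CC.
    move=> j; case: (Hx j) => jx; last by left; apply/compl_case.
    by right; apply/compl_case; rewrite complK.
- move=> S SD; have [x [ubx lubx] Cx] := Csup S (DS _ SD).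
  exists x => //; split=> // j.
  have [[y Sy jy]|nS] := pselect (exists2 y, S y & (H j <= y)%O).
    by left; apply: le_trans jy (ubx _ Sy).
  (* An [H j] below no member of [S] excludes all of them, so its complement is an upper bound of
     [S]. *)
  right; apply/compl_case; rewrite lexC; apply: lubx => y Sy.
  rewrite lexC; apply/compl_case; have [_ /(_ j) []//] := SD _ Sy.
  by move=> jy; case: nS; exists y.
- move=> S SD; have [x [lbx glbx] Cx] := Cinf S (DS _ SD).
  exists x => //; split=> // j.
  have [[y Sy jy]|nS] := pselect (exists2 y, S y & (H j `&` y)%O = \bot%O).
    right; apply/le_anti; rewrite le0x andbT -jy leI2 //.
    exact: lbx.
  left; apply: glbx => y Sy; have [_ /(_ j) []//] := SD _ Sy.
  by move=> jy; case: nS; exists y.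
(* The atoms are the [H j]: one that meets [x] lies below [x]. *)
- move=> x [Cx Hx] x0; have [j jx] := partition_meet pH x0.
  exists (H j); last by case: (Hx j).
  split.
  + split; first by apply: HC; exists j.
    move=> k; have [->|kj] := pselect (k = j); first by left.
    by right; case: pH => _ dH _; apply: dH.
  + by case: pH.
  + move=> y [Cy /(_ j) [jy|jy]] yj; [right|left].
      by apply/le_anti; rewrite yj jy.
    by apply/eqP; rewrite -(meet_idPr yj) jy.
Qed.

(** * Finitely additive probabilities *)

Section FinitelyAdditive.
Context {d : Order.disp_t} {T : ctbDistrLatticeType d} {R : realType}.
Variables (A : set T) (mu : T -> R).
Hypotheses (algA : boolean_subalgebra A) (fa_mu : fa_probability A mu).

Lemma fa_bot : mu \bot%O = 0.
Proof.
case: algA => Abot _ _ _ _; case: fa_mu => _ _ /(_ _ _ Abot Abot).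
by rewrite meetxx joinxx => /(_ erefl) /eqP; rewrite -subr_eq subrr => /eqP.
Qed.

Lemma fa_top_neq_bot : (\top : T)%O <> \bot%O.
Proof.
case: fa_mu => _ mu1 _ T0; move: mu1; rewrite T0 fa_bot => /esym/eqP.
by rewrite oner_eq0.
Qed.

Lemma fa_le E F : A E -> A F -> (E <= F)%O -> mu E <= mu F.
Proof.
case: algA => Abot _ AI AU AN AE AF EF; case: fa_mu => mu0 _ muU.
have AFE : A (F `&` ~` E)%O by apply: AI => //; apply: AN.
have EFE : (E `&` (F `&` ~` E))%O = \bot%O by rewrite meetCA meetxC meetx0.
have <- : (E `|` (F `&` ~` E))%O = F.
  by rewrite joinIr joinxC meetx1; apply/join_idPr.
by rewrite muU// lerDl mu0.
Qed.

Lemma fa_compl E : A E -> mu (~` E)%O = 1 - mu E.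
Proof.
case: algA => _ _ _ _ AN; case: fa_mu => _ <- muU AE.
by rewrite -(joinxC E) muU ?meetxC//; [rewrite [mu E + _]addrC addrK|exact: AN].
Qed.

Lemma fa_meet_null E F : A E -> A F -> mu F = 0 -> mu (E `&` F)%O = 0.
Proof.
case: algA => _ _ AI _ _ AE AF muF; apply/le_anti.
rewrite -{1}muF fa_le ?leIr//=; last exact: AI.
by case: fa_mu => mu0 _ _; apply: mu0; exact: AI.
Qed.

Lemma fa_meet_full E F : A E -> A F -> mu F = 1 -> mu (E `&` F)%O = mu E.
Proof.
case: algA => _ _ AI _ AN AE AF muF; case: fa_mu => _ _ muU.
have AFC := AN _ AF.
have muFC : mu (E `&` ~` F)%O = 0.
  by apply: fa_meet_null => //; rewrite fa_compl// muF subrr.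
have EFFC : (E `&` F `&` (E `&` ~` F) = \bot)%O.
  by rewrite meetACA meetxC meetx0.
rewrite -[in RHS](meetx1 E) -(joinxC F) meetUr muU ?muFC ?addr0//; exact: AI.
Qed.

End FinitelyAdditive.

(** * Lexicographic full conditional probabilities *)

(** Choose the minimum for the order that compares ranks first and breaks ties by a well-ordering of
    [X]. The minimum of [S] remains the minimum of every subset that still contains it. *)
Lemma ranked_consistent_choice (X : Type) (rank : X -> nat) :
  exists c : set X -> option X,
    (forall S : set X, S !=set0 ->
       exists x, [/\ c S = Some x, S x & forall y, S y -> (rank x <= rank y)%N]) /\
    (forall (S S' : set X) x, c S = Some x -> S' `<=` S -> S' x -> c S' = c S).
Proof.
have [leX woX] := wochoice.well_ordering_principle {classic X}.
pose first (S : set X) (x : X) := [/\ S x, forall y, S y -> (rank x <= rank y)%N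
  & forall y, S y -> rank y = rank x -> leX x y].
have first_ex S : S !=set0 -> exists x, first S x.
  move=> [x0 Sx0].
  have exn : exists n, `[< exists2 x, S x & rank x = n >].
    by exists (rank x0); apply/asboolP; exists x0.
  case: (ex_minnP exn) => n /asboolP[x1 Sx1 rx1] minn.
  have [|x [[xS minx] _]] := woX [pred x | `[< S x /\ rank x = n >]].
    by exists x1; apply/asboolP; split.
  move: xS => /asboolP [Sx rx].
  exists x; split => //.
    by move=> y Sy; rewrite rx; apply: minn; apply/asboolP; exists y.
  by move=> y Sy ry; apply: minx; apply/asboolP; rewrite ry.
have first_uniq S x y : first S x -> first S y -> x = y.
  move=> [Sx rx mx] [Sy ry my].
  have rxy : rank x = rank y by apply/eqP; rewrite eqn_leq rx ?ry.
  (* Both [x] and [y] are minima of the pair they form, and a well-ordering has unique minima. *)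
  have [|z [_ Uz]] := woX [pred z | `[< z = x \/ z = y >]].
    by exists x; apply/asboolP; left.
  transitivity z; [symmetry|]; apply: Uz; split.
  - by apply/asboolP; left.
  - by move=> z' /asboolP[] ->; [exact: mx|exact: mx].
  - by apply/asboolP; right.
  - by move=> z' /asboolP[] ->; [exact: my|exact: my].
pose c S := if pselect (exists x, first S x) is left h
  then Some (projT1 (cid h)) else None.
have cP S x : c S = Some x <-> first S x.
  rewrite /c; case: pselect => [h|nh]; last by split => // ?; case: nh; exists x.
  case: cid => y fy /=; split => [[<-]//|fx]; congr Some.
  exact: first_uniq fy fx.
exists c; split.
  move=> S /first_ex [x fx]; exists x; split; [exact/cP| by case: fx..].
move=> S S' x cS SS S'x; rewrite cS; apply/cP; move/cP : cS => [Sx rx mx].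
by split=> // y /SS; [exact: rx|exact: mx].
Qed.

(* Condition on the first measure of the family that charges the conditioning
   event: the chain rule holds because a measure charging [E `&` K] and first
   for [K] is also first for [E `&` K]. *)
Lemma lexicographic_fcp {d : Order.disp_t} {T : ctbDistrLatticeType d}
    {R : realType} (A : set T) (W : Type) (mu : W -> T -> R) (rank : W -> nat) :
  boolean_subalgebra A -> (forall w, fa_probability A (mu w)) ->
  (forall K, nonimpossible A K -> exists w, 0 < mu w K) ->
  exists Q : T -> T -> R, full_conditional_probability A Q /\
    forall K, nonimpossible A K -> exists w, [/\ 0 < mu w K,
      forall v, 0 < mu v K -> (rank w <= rank v)%N
      & forall E, Q E K = mu w (E `&` K)%O / mu w K].
Proof.
move=> algA famu covA; have [c [cP cS]] := ranked_consistent_choice rank.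
have [_ Atop AI AU AN] := algA.
pose S K := [set w | 0 < mu w K].
pose Q E K := if c (S K) is Some w then mu w (E `&` K)%O / mu w K else 0.
have QP K : nonimpossible A K -> exists w, [/\ c (S K) = Some w, 0 < mu w K,
      forall v, 0 < mu v K -> (rank w <= rank v)%N
      & forall E, Q E K = mu w (E `&` K)%O / mu w K].
  move=> /covA /(cP (S K)) [w [cw Sw rw]]; exists w; split => // E.
  by rewrite /Q cw.
exists Q; split; last by move=> K /QP [w [_ ? ? ?]]; exists w.
split.
- move=> E K AE AK; have [w [_ w0 _ ->]] := QP _ AK; case: AK => AK _.
  have [mu0 _ _] := famu w.
  rewrite divr_ge0 ?mu0 ?ler_pdivrMr ?mul1r//=; last exact: AI.
  by apply: (fa_le algA (famu w)) => //; [exact: AI|exact: leIr].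
- move=> E K AE AK; have [w [_ w0 _ QE]] := QP _ AK.
  by rewrite !QE -meetA meetxx.
- move=> K AK; have [w [_ w0 _ QE]] := QP _ AK; case: AK => AK _.
  have [mu0 _ muU] := famu w; split.
  + by move=> E AE; rewrite QE divr_ge0 ?mu0//; exact: AI.
  + by rewrite QE meet1x divff// gt_eqF.
  + move=> E F AE AF EF; rewrite !QE meetUl -mulrDl muU//; try exact: AI.
    by rewrite meetACA EF meet0x.
- move=> E F K AE AF AK AEK; have [w [cw w0 _ QE]] := QP _ AK.
  have [[AK' _] [AEK' _]] := (AK, AEK).
  have [mu0 _ _] := famu w.
  have [wEK|] := ltP 0 (mu w (E `&` K)%O).
    have cEK : c (S (E `&` K)%O) = c (S K).
      apply: cS cw _ _ => // v; rewrite /S /= => /lt_le_trans; apply.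
      by apply: (fa_le algA (famu v)) => //; exact: leIr.
    rewrite !QE /Q cEK cw (meetC E) -meetA.
    by field; rewrite !gt_eqF.
  (* If [w] does not charge the meet of [E] and [K], both sides of the chain rule are 0, whichever
     measure is chosen for that meet. *)
  move=> wEK; have wEK0 : mu w (E `&` K)%O = 0.
    by apply/le_anti; rewrite wEK mu0.
  rewrite !QE wEK0 !mul0r (meetC E) -meetA.
  by rewrite (fa_meet_null algA (famu w))// ?mul0r.
Qed.

(** * Conditions that pass to the closure *)

Section Continuity.
Context {X : topologicalType} {R : realType} (S : set X) (p : X).
Implicit Types g h : X -> R.

Lemma continuous_fun_add g h :
  continuous g -> continuous h -> continuous (fun x => g x + h x).
Proof. by move=> cg ch x; apply: cvgD; [exact: cg|exact: ch]. Qed.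

Lemma continuous_fun_sub g h :
  continuous g -> continuous h -> continuous (fun x => g x - h x).
Proof. by move=> cg ch x; apply: cvgB; [exact: cg|exact: ch]. Qed.

Lemma continuous_fun_mul g h :
  continuous g -> continuous h -> continuous (fun x => g x * h x).
Proof. by move=> cg ch x; apply: cvgM; [exact: cg|exact: ch]. Qed.

(** The set where [h - g] is nonnegative is closed and contains [S], hence also the closure of
    [S]. *)
Lemma closure_continuous_le g h :
  continuous g -> continuous h -> closure S p ->
  (forall x, S x -> g x <= h x) -> g p <= h p.
Proof.
move=> cg ch Sp gh; rewrite -subr_ge0.
have : closed ((fun x => h x - g x) @^-1` [set y | 0 <= y]).
  apply: preimage_closed => [x _|]; last exact: closed_ge.
  exact: continuous_fun_sub.
apply; apply: closure_subset Sp => x Sx.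
by rewrite /= subr_ge0 gh.
Qed.

Lemma closure_continuous_eq g h :
  continuous g -> continuous h -> closure S p ->
  (forall x, S x -> g x = h x) -> g p = h p.
Proof.
move=> cg ch Sp gh; apply/le_anti/andP.
by split; apply: closure_continuous_le => // x Sx; rewrite gh.
Qed.

End Continuity.

(** * Mixtures of the strategy and disintegration along the prior *)

Section Mixture.
Context {d : Order.disp_t} {T : ctbDistrLatticeType d} {R : realType}.
Variables (I : Type) (A AL : set T) (H : I -> T) (sigma : T -> T -> R).
Variable prior : T -> R.
Hypotheses (algA : boolean_subalgebra A) (algAL : boolean_subalgebra AL).
Hypotheses (ALA : AL `<=` A) (ALH : forall i, AL (H i)).
Hypothesis atomH : forall B i, AL B -> (H i <= B)%O \/ (H i `&` B)%O = \bot%O.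
Hypothesis meetH : forall B, B <> \bot%O -> exists i, (H i `&` B)%O <> \bot%O.
Hypotheses (strat : strategy A H sigma) (fa_prior : fa_probability AL prior).

Lemma strategy_in D i : AL D -> (H i <= D)%O -> sigma D (H i) = 1.
Proof.
case: strat => _ s1 _ AD iD; apply: s1; first exact: ALA.
exact/meet_idPr.
Qed.

Lemma strategy_out D i :
  AL D -> (H i `&` D)%O = \bot%O -> sigma D (H i) = 0.
Proof.
case: strat => _ _ sfa AD iD; have AAD := ALA AD.
have : sigma (~` D)%O (H i) = 1.
  case: algAL => _ _ _ _ AN; apply: strategy_in; first exact: AN.
  by rewrite -disj_leC; apply/eqP.
by rewrite (fa_compl algA (sfa i) AAD) => ?; lra.
Qed.

Lemma strategy_meet_in F D i :
  A F -> AL D -> (H i <= D)%O -> sigma (F `&` D)%O (H i) = sigma F (H i).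
Proof.
case: strat => _ _ sfa AF AD iD.
by apply: (fa_meet_full algA (sfa i)) => //; [exact: ALA|exact: strategy_in].
Qed.

Lemma strategy_meet_out F D i :
  A F -> AL D -> (H i `&` D)%O = \bot%O -> sigma (F `&` D)%O (H i) = 0.
Proof.
case: strat => _ _ sfa AF AD iD.
by apply: (fa_meet_null algA (sfa i)) => //; [exact: ALA|exact: strategy_out].
Qed.

(** Arbitrary bounds [a] and [b] stand in for the infimum and supremum: bounds valid on [D] are
    inherited by its sub-blocks, and taking [a = b] turns inequalities into equalities. *)
Definition between (F D : T) (a b : R) : Prop :=
  forall i, (H i <= D)%O -> a <= sigma F (H i) <= b.

Definition disintegrates (nu : T -> R) (D : T) : Prop :=
  forall F a b, A F -> between F D a b ->
    a * prior D <= nu (F `&` D)%O <= b * prior D.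

(* Split [B] along the events of [s] and, on each nonempty block, use the
   strategy at one [H i] below that block. *)
Lemma finite_disintegration (s : seq T) (B : T) :
  (forall D, D \in s -> AL D) -> AL B ->
  exists nu : T -> R,
    [/\ forall E F, A E -> A F -> (E `&` F)%O = \bot%O ->
          nu (E `|` F)%O = nu E + nu F,
        forall F a b, A F -> between F B a b -> a * prior B <= nu F <= b * prior B
      & forall D F a b, D \in s -> A F -> between F D a b ->
          a * prior (D `&` B)%O <= nu (F `&` D)%O <= b * prior (D `&` B)%O].
Proof.
have [ALbot _ ALI _ ALC] := algAL; have [_ _ AI _ _] := algA.
have [prior0 _ priorU] := fa_prior; have [_ _ sfa] := strat.
have priorS C D : AL C -> AL D -> prior D = prior (D `&` C)%O + prior (D `&` ~` C)%O.
  move=> AN AD; rewrite -priorU; try by apply: ALI => //; exact: ALC.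
    by rewrite -meetUr joinxC meetx1.
  by rewrite meetACA meetxC meetx0.
elim: s B => [|C s IH] B ALs ALB.
  (* An empty block has prior 0, so the zero function serves; any other block contains some
     [H i]. *)
  have [B0|/meetH [i iB]] := pselect (B = \bot%O).
    exists (fun=> 0); rewrite B0 (fa_bot algAL fa_prior).
    by split => // *; rewrite ?addr0 // !mulr0 lexx.
  exists (fun F => sigma F (H i) * prior B); split => //.
    by move=> E F AE AF EF; have [_ _ ->//] := sfa i; rewrite mulrDl.
  have {}iB : (H i <= B)%O by case: (atomH i ALB).
  by move=> F a b AF /(_ i iB) /andP[aF Fb]; rewrite !ler_wpM2r ?prior0.
have ALC' : AL C by apply: ALs; rewrite inE eqxx.
have ALs' D : D \in s -> AL D by move=> Ds; apply: ALs; rewrite inE Ds orbT.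
have ALBC : AL (B `&` C)%O by exact: ALI.
have ALBC' : AL (B `&` ~` C)%O by apply: ALI => //; exact: ALC.
have [nu1 [add1 tot1 dis1]] := IH _ ALs' ALBC.
have [nu2 [add2 tot2 dis2]] := IH _ ALs' ALBC'.
exists (fun F => nu1 F + nu2 F); split.
- by move=> E F AE AF EF; rewrite add1// add2// addrACA.
- move=> F a b AF FB.
  have /andP[l1 u1] : a * prior (B `&` C)%O <= nu1 F <= b * prior (B `&` C)%O.
    by apply: tot1 => // i; rewrite lexI => /andP[iB _]; exact: FB.
  have /andP[l2 u2] : a * prior (B `&` ~` C)%O <= nu2 F <= b * prior (B `&` ~` C)%O.
    by apply: tot2 => // i; rewrite lexI => /andP[iB _]; exact: FB.
  by rewrite (priorS C B)// !mulrDr !lerD.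
- move=> D F a b; rewrite inE => /orP[/eqP ->|Ds] AF FD; last first.
    have ALD := ALs' _ Ds.
    have /andP[l1 u1] := dis1 D F a b Ds AF FD.
    have /andP[l2 u2] := dis2 D F a b Ds AF FD.
    by rewrite (priorS C (D `&` B)%O ALC' (ALI _ _ ALD ALB)) -!meetA !mulrDr !lerD.
  have AFC : A (F `&` C)%O by apply: AI => //; exact: ALA.
  have /andP[l1 u1] : a * prior (B `&` C)%O <= nu1 (F `&` C)%O
      <= b * prior (B `&` C)%O.
    apply: tot1 => // i; rewrite lexI => /andP[iB iC].
    by rewrite strategy_meet_in//; exact: FD.
  (* Each [H i] below the block outside [C] gives [C] probability 0, so the bounds [a = b = 0] make
     [nu2] vanish on the meet of [F] and [C]. *)
  have : 0 * prior (B `&` ~` C)%O <= nu2 (F `&` C)%O <= 0 * prior (B `&` ~` C)%O.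
    apply: tot2 => // i; rewrite lexI => /andP[iB iC].
    rewrite strategy_meet_out ?lexx//.
    by move: iC; rewrite -disj_leC => /eqP.
  rewrite mul0r => /le_anti <-; rewrite addr0 (meetC C).
  by rewrite l1 u1.
Qed.

(** [G s] asks for disintegration only along the events of the finite list [s], so a mixture
    provides an element. These sets generate a proper filter on a compact cube; a cluster point lies
    in the closure of each [G s], and every condition required of [mu] is closed. *)
Lemma ex_disintegration : exists mu : T -> R,
  fa_probability A mu /\ forall D, AL D -> disintegrates mu D.
Proof.
have [Abot Atop AI AU AN] := algA; have [_ ALtop ALI _ _] := algAL.
have [prior0 prior1 _] := fa_prior; have [sge0 _ sfa] := strat.
pose X := {ptws T -> R}.
pose cube : set X := [set f | forall x, `[0, 1]%classic (f x)].
pose G (s : seq T) : set X := [set f | [/\ cube f, fa_probability A f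
  & forall D, D \in s -> AL D -> disintegrates f D]].
have cptK : compact cube.
  apply: (@tychonoff T (fun=> R) (fun=> `[0, 1]%classic)) => _.
  exact: segment_compact.
have Gex s : G s !=set0.
  pose s' := [seq D <- s | `[< AL D >]].
  have [D|nu [addnu totnu disnu]] := @finite_disintegration s' _ _ ALtop.
    by rewrite mem_filter => /andP[/asboolP].
  have nu01 F : A F -> 0 <= nu F <= 1.
    move=> AF; have := totnu F 0 1 AF; rewrite mul0r prior1 mul1r; apply.
    by move=> i _; exact: sge0.
  (* The mixture is controlled only on [A]; the value 0 elsewhere keeps the function in the cube. *)
  exists (fun F => if `[< A F >] then nu F else 0); split.
  + move=> F /=; rewrite in_itv/=; case: asboolP => [/nu01//|_].
    by rewrite lexx ler01.
  + split.
    * by move=> F AF; case: asboolP => // _; case/andP: (nu01 _ AF).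
    (* Since [sigma] gives the top event probability 1 under each [H i], the bounds [a = b = 1] fix
       the total mass at the prior of the top event, which is 1. *)
    * rewrite asboolT//; have := totnu \top%O 1 1 Atop.
      rewrite prior1 mulr1 => /(_ _)/le_anti <- //.
      by move=> i _; have [_ -> _] := sfa i; rewrite lexx.
    * by move=> E F AE AF EF; rewrite !asboolT ?addnu//; exact: AU.
  + move=> D Ds ALD F a b AF FD; rewrite asboolT; last first.
      by apply: AI => //; exact: ALA.
    have := @disnu D F a b; rewrite meetx1; apply => //.
    by rewrite mem_filter Ds andbT; apply/asboolP.
have FF : Filter (filter_from [set: seq T] G).
  apply: filter_from_filter; first by exists [::].
  move=> s t _ _; exists (s ++ t) => // f [cf ff Df].
  by split; split => // D Ds; apply: Df; rewrite mem_cat Ds ?orbT.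
have PF : ProperFilter (filter_from [set: seq T] G).
  by apply: filter_from_proper => s _; exact: Gex.
have [|mu [_ clmu]] := cptK _ PF; first by exists [::] => // f [].
have Gmu s : closure (G s) mu.
  by move=> B nB; apply: clmu => //; exists s.
have ev x : continuous (fun f : X => f x).
  exact: (@proj_continuous T (fun=> R) x).
exists mu; split; first split.
- move=> E AE.
  apply: (closure_continuous_le (@cst_continuous X R 0) (ev E) (Gmu [::])).
  by move=> f [_ [+ _ _] _]; apply.
- apply: (closure_continuous_eq (ev \top%O) (@cst_continuous X R 1) (Gmu [::])).
  by move=> f [_ []].
- move=> E F AE AF EF.
  have cEF : continuous (fun f : X => f E + f F).
    exact: continuous_fun_add.
  apply: (closure_continuous_eq (ev _) cEF (Gmu [::])).
  by move=> f [_ [_ _ +] _]; apply.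
- move=> D ALD F a b AF FD.
  have GD f : G [:: D] f -> a * prior D <= f (F `&` D)%O <= b * prior D.
    by move=> [_ _ /(_ D)]; rewrite inE eqxx; apply.
  have cst a' : continuous (fun _ : X => a' : R) by exact: cst_continuous.
  apply/andP; split.
    by apply: (closure_continuous_le (cst _) (ev _) (Gmu [:: D])) => f /GD/andP[].
  by apply: (closure_continuous_le (ev _) (cst _) (Gmu [:: D])) => f /GD/andP[].
Qed.

End Mixture.

(** * Compactness of the set of conglomerable extensions *)

(** The subtype is the image of the compact set [K] under a map continuous on [K]. The point [y] is
    the default value of that map off [K], hence the separate empty case. *)
Lemma compact_set_type {X : topologicalType} (K : set X) :
  compact K -> compact [set: set_type K].
Proof.
move=> cK; have [->|/set0P[y _]] := eqVneq [set: set_type K] set0.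
  exact: compact0.
have cid : continuous (fun x : set_type K => x) by move=> x; exact: cvg_id.
suff -> : [set: set_type K] = valL_ y (fun x : set_type K => x) @` K.
  by apply: continuous_compact => //; exact/subspace_valL_continuousP'.
apply/seteqP; split => // x _; exists (set_val x); first exact: set_valP.
exact: (congr1 (@^~ x) (valLK y (fun x : set_type K => x))).
Qed.

Section Extension.
Context {d : Order.disp_t} {T : ctbDistrLatticeType d} {R : realType}.
Variable A : set T.
Local Notation X := {ptws (set_type A * set_type (nonimpossible A))%type
  -> set_type (`[0, 1]%classic : set R)}.

(** Turns a point of the product space into a total function, the form in which the conditions on
    conditional probabilities are stated, by a formula that is continuous in [f]. *)
Definition extend_by0 (f : X) (E K : T) : R :=
  if (insub E : option (set_type A), insub K : option (set_type (nonimpossible A)))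
    is (Some e, Some k) then set_val (f (e, k)) else 0.

Lemma extend_by0_val f (E : set_type A) (K : set_type (nonimpossible A)) :
  extend_by0 f (set_val E) (set_val K) = set_val (f (E, K)).
Proof. by rewrite /extend_by0 !valK. Qed.

Lemma extend_by0_eq f (Q : T -> T -> R) E K :
  (forall (E : set_type A) (K : set_type (nonimpossible A)),
     set_val (f (E, K)) = Q (set_val E) (set_val K)) ->
  A E -> nonimpossible A K -> extend_by0 f E K = Q E K.
Proof.
move=> fQ AE AK.
pose e : set_type A := exist _ E (mem_set AE).
pose k : set_type (nonimpossible A) := exist _ K (mem_set AK).
exact: etrans (extend_by0_val f e k) (fQ e k).
Qed.

(** The map is either constant or a coordinate projection followed by the inclusion of the unit
    interval. *)
Lemma continuous_extend_by0 E K : continuous (fun f : X => extend_by0 f E K).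
Proof.
rewrite /extend_by0; case: insub => [e|]; last exact: cst_continuous.
case: insub => [k|]; last exact: cst_continuous.
move=> f; apply: (@continuous_comp X (set_type (`[0, 1]%classic : set R)) R
  (fun f : X => f (e, k)) set_val).
  exact: (@proj_continuous _ (fun=> set_type (`[0, 1]%classic : set R)) (e, k)).
exact: initial_continuous.
Qed.

End Extension.

(** * Transfer of the conditions between functions agreeing on the domain *)

Section Transfer.
Context {d : Order.disp_t} {T : ctbDistrLatticeType d} {R : realType}.
Variables (A AL : set T) (I : Type) (H : I -> T).
Variables (prior : T -> R) (sigma P Q : T -> T -> R).
Hypotheses (algA : boolean_subalgebra A) (ALA : AL `<=` A).
Hypothesis PQ : forall E K, A E -> nonimpossible A K -> P E K = Q E K.

Lemma full_conditional_probability_eq :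
  full_conditional_probability A Q -> full_conditional_probability A P.
Proof.
have [_ Atop AI AU _] := algA => -[c0 c1 c2 c3]; split.
- by move=> E K AE AK; rewrite PQ//; exact: c0.
- move=> E K AE AK; rewrite !PQ//; first exact: c1.
  by apply: AI => //; case: AK.
- move=> K AK; have [m0 m1 mU] := c2 _ AK; split.
  + by move=> E AE; rewrite PQ//; exact: m0.
  + by rewrite PQ.
  + by move=> E F AE AF EF; rewrite !PQ//; [exact: mU|exact: AU].
- move=> E F K AE AF AK AEK; rewrite !PQ//; first exact: c3.
  exact: AI.
Qed.

Lemma extends_prior_strategy_eq :
  nonimpossible A \top%O -> (forall i, nonimpossible A (H i)) ->
  extends_prior_strategy A AL H prior sigma Q ->
  extends_prior_strategy A AL H prior sigma P.
Proof.
move=> Atop AH [Qprior Qsigma]; split => [E ALE|F i AF]; rewrite PQ//.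
- exact: Qprior.
- exact: ALA.
- exact: Qsigma.
Qed.

Lemma fully_strongly_conglomerable_eq :
  fully_strongly_conglomerable A AL H sigma Q ->
  fully_strongly_conglomerable A AL H sigma P.
Proof.
have [_ _ AI _ _] := algA.
move=> Qc F K E AF [ALK K0] ALE EK; rewrite !PQ //; try by split=> //; exact: ALA.
- exact: Qc.
- by apply: AI => //; exact: ALA.
- exact: ALA.
Qed.

End Transfer.

Lemma compact_Qfsc {d : Order.disp_t} {T : ctbDistrLatticeType d}
    {R : realType} (A AL : set T) (I : Type) (H : I -> T) (prior : T -> R)
    (sigma : T -> T -> R) :
  boolean_subalgebra A -> AL `<=` A ->
  nonimpossible A \top%O -> (forall i, nonimpossible A (H i)) ->
  compact (Qfsc A AL H prior sigma).
Proof.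
move=> algA ALA Atop AH; have [_ _ AI AU _] := algA.
pose X := {ptws (set_type A * set_type (nonimpossible A))%type
  -> set_type (`[0, 1]%classic : set R)}.
pose S : set X := Qfsc A AL H prior sigma.
have cptX : compact [set: X].
  pose Y := set_type (`[0, 1]%classic : set R).
  suff -> : [set: X] = [set f : X | forall i, [set: Y] (f i)].
    apply: (@tychonoff _ (fun=> Y) (fun=> setT)) => _.
    by apply: compact_set_type; exact: segment_compact.
  by apply/seteqP; split.
apply: (subclosed_compact (B := [set: X])) => //.
(* Replacing the existential witness by [extend_by0 f] turns membership in [S] into relations
   between continuous functions of [f], which survive in the closure. *)
have S_ext (f : X) : S f -> [/\ full_conditional_probability A (extend_by0 f),
    extends_prior_strategy A AL H prior sigma (extend_by0 f)
    & fully_strongly_conglomerable A AL H sigma (extend_by0 f)].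
  move=> [Q [fQ Q1 Q2 Q3]]; split.
  - by apply: full_conditional_probability_eq Q1 => // E K; exact: extend_by0_eq.
  - by apply: extends_prior_strategy_eq Q2 => // E K; exact: extend_by0_eq.
  - by apply: fully_strongly_conglomerable_eq Q3 => // E K; exact: extend_by0_eq.
move=> p Sp.
have ev E K : continuous (fun f : X => extend_by0 f E K).
  exact: continuous_extend_by0.
have cst a : continuous (fun _ : X => a : R) by exact: cst_continuous.
exists (extend_by0 p); split.
- by move=> E K; rewrite extend_by0_val.
- split.
  + move=> E K AE AK; apply/andP; split.
      apply: (closure_continuous_le (cst _) (ev _ _) Sp) => f.
      by move=> /S_ext[[c0 _ _ _] _ _]; case/andP: (c0 _ _ AE AK).
    apply: (closure_continuous_le (ev _ _) (cst _) Sp) => f.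
    by move=> /S_ext[[c0 _ _ _] _ _]; case/andP: (c0 _ _ AE AK).
  + move=> E K AE AK; apply: (closure_continuous_eq (ev _ _) (ev _ _) Sp) => f.
    by move=> /S_ext[[_ c1 _ _] _ _]; exact: c1.
  + move=> K AK; split.
    * move=> E AE; apply: (closure_continuous_le (cst _) (ev _ _) Sp) => f.
      by move=> /S_ext[[_ _ c2 _] _ _]; case: (c2 _ AK) => + _ _; exact.
    * apply: (closure_continuous_eq (ev _ _) (cst _) Sp) => f.
      by move=> /S_ext[[_ _ c2 _] _ _]; case: (c2 _ AK).
    * move=> E F AE AF EF.
      apply: (closure_continuous_eq (ev _ _)
        (continuous_fun_add (ev _ _) (ev _ _)) Sp) => f.
      by move=> /S_ext[[_ _ c2 _] _ _]; case: (c2 _ AK) => _ _; exact.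
  + move=> E F K AE AF AK AEK.
    apply: (closure_continuous_eq (ev _ _)
      (continuous_fun_mul (ev _ _) (ev _ _)) Sp) => f.
    by move=> /S_ext[[_ _ _ c3] _ _]; exact: c3.
- split.
  + move=> E ALE; apply: (closure_continuous_eq (ev _ _) (cst _) Sp) => f.
    by move=> /S_ext[_ [+ _] _]; exact.
  + move=> F i AF; apply: (closure_continuous_eq (ev _ _) (cst _) Sp) => f.
    by move=> /S_ext[_ [_ +] _]; exact.
- move=> F K E AF ALK ALE EK; apply/andP; split.
    apply: (closure_continuous_le
      (continuous_fun_mul (ev _ _) (cst _)) (ev _ _) Sp) => f.
    by move=> /S_ext[_ _ Qc]; case/andP: (Qc F K E AF ALK ALE EK).
  apply: (closure_continuous_le (ev _ _)
    (continuous_fun_mul (ev _ _) (cst _)) Sp) => f.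
  by move=> /S_ext[_ _ Qc]; case/andP: (Qc F K E AF ALK ALE EK).
Qed.

(** * Existence of a conglomerable extension *)

(** An atom implies or excludes each event of [A], and cannot imply two incompatible ones; so its
    point mass is additive. *)
Lemma atom_fa_probability {d : Order.disp_t} {T : ctbDistrLatticeType d}
    {R : realType} (A C : set T) (a : T) :
  A `<=` C -> complete_atomic_subalgebra C -> atom_of C a ->
  fa_probability A (fun E => ((a <= E)%O%:R : R)).
Proof.
move=> AC [[_ _ CI _ _] _ _ _] [Ca a0 amin]; split.
- by move=> E _; rewrite ler0n.
- by rewrite lex1.
- move=> E F AE AF EF.
  have aE E' : A E' -> (a `&` E')%O = \bot%O \/ (a <= E')%O.
    move=> AE'; have := amin (a `&` E')%O (CI _ _ Ca (AC _ AE')) (leIl _ _).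
    by case=> [|/meet_idPl]; [left|right].
  case: (aE _ AE) => [aE0|aEle]; case: (aE _ AF) => [aF0|aFle].
  + have nE E' : (a `&` E')%O = \bot%O -> (a <= E')%O = false.
      by move=> aE'; apply/negP => /meet_idPl aE''; apply: a0; rewrite -aE''.
    by rewrite !nE ?addr0// meetUr aE0 aF0 joinx0.
  + have -> : (a <= E)%O = false.
      by apply/negP => /meet_idPl aE'; apply: a0; rewrite -aE'.
    by rewrite lexU2 aFle ?orbT// add0r.
  + have -> : (a <= F)%O = false.
      by apply/negP => /meet_idPl aE'; apply: a0; rewrite -aE'.
    by rewrite lexU2 aEle// addr0.
  + by case: a0; apply/le_anti; rewrite le0x andbT -EF lexI aEle.
Qed.

Section Existence.
Context {d : Order.disp_t} {T : ctbDistrLatticeType d} {R : realType}.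
Variables (I : Type) (A AL C : set T) (H : I -> T) (sigma : T -> T -> R).
Variable prior : T -> R.
Hypotheses (algA : boolean_subalgebra A) (algAL : boolean_subalgebra AL).
Hypotheses (ALA : AL `<=` A) (ALH : forall i, AL (H i)).
Hypotheses (partH : is_partition H) (CA : A `<=` C).
Hypothesis catC : complete_atomic_subalgebra C.
Hypothesis atomH : forall B i, AL B -> (H i <= B)%O \/ (H i `&` B)%O = \bot%O.
Hypotheses (strat : strategy A H sigma) (fa_prior : fa_probability AL prior).

Lemma ex_conglomerable_fcp : exists Q : T -> T -> R,
  [/\ full_conditional_probability A Q,
      extends_prior_strategy A AL H prior sigma Q
    & fully_strongly_conglomerable A AL H sigma Q].
Proof.
have [Abot Atop AI AU AN] := algA; have [_ ALtop ALI _ _] := algAL.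
have [sigma01 sigma1 sfa] := strat.
have [H0 Hdisj _] := partH.
have meetH B := @partition_meet _ _ _ H B partH.
have [mu [fa_mu dis_mu]] :=
  ex_disintegration algA algAL ALA atomH meetH strat fa_prior.
pose W := (unit + I + {a | atom_of C a})%type.
pose layer (w : W) : T -> R := match w with
  | inl (inl _) => mu
  | inl (inr i) => fun E => sigma E (H i)
  | inr a => fun E => (sval a <= E)%O%:R
  end.
pose rank (w : W) := match w with
  inl (inl _) => 0%N | inl (inr _) => 1%N | inr _ => 2%N end.
have fa_layer w : fa_probability A (layer w).
  case: w => [[[]|i]|[a aC]] //=; exact: atom_fa_probability catC aC.
(* Below every non-impossible event there is an atom, so the last layer charges everything. *)
have cover K : nonimpossible A K -> exists w, 0 < layer w K.
  move=> [AK K0]; have [_ _ _ /(_ K (CA AK) K0) [a aC aK]] := catC.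
  by exists (inr (exist _ a aC)); rewrite /= aK ltr01.
have [Q [fcpQ QE]] := lexicographic_fcp rank algA fa_layer cover.
have T0 := fa_top_neq_bot algAL fa_prior.
(* Disintegrating the top event with bounds [a = b = 1] shows that [mu] extends the prior. *)
have mu_prior B : AL B -> mu B = prior B.
  move=> ALB; have : 1 * prior B <= mu (\top `&` B)%O <= 1 * prior B.
    apply: dis_mu => // i _; rewrite sigma1 ?lexx//; exact: meet1x.
  by rewrite meet1x mul1r => /le_anti <-.
have AL0A K : nonimpossible AL K -> nonimpossible A K.
  by move=> [ALK K0]; split => //; exact: ALA.
have s_in D i := @strategy_in _ _ _ _ _ _ _ _ ALA strat D i.
have s_out D i := @strategy_out _ _ _ _ _ _ _ _ algA algAL ALA strat D i.
have sm_in F D i := @strategy_meet_in _ _ _ _ _ _ _ _ algA ALA strat F D i.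
have sm_out F D i := @strategy_meet_out _ _ _ _ _ _ _ _ algA algAL ALA strat F D i.
(* Conditioning on an event of [AL] yields either the normalized [mu] or, at prior 0, a single
   member of the strategy lying below it. *)
have QAL K : nonimpossible AL K ->
    (0 < prior K /\ forall E, A E -> Q E K = mu (E `&` K)%O / prior K) \/
    (prior K <= 0 /\ exists2 i, (H i <= K)%O &
       forall E, A E -> Q E K = sigma E (H i)).
  move=> ALK0; have [w [w0 wmin Qw]] := QE _ (AL0A _ ALK0).
  have [ALK K0] := ALK0; have [i iK] := meetH _ K0.
  have {}iK : (H i <= K)%O by case: (atomH i ALK).
  case: w w0 wmin Qw => [[[]|j]|a] /= w0 wmin Qw.
  - by left; rewrite -mu_prior//; split.
  - right; split.
      rewrite leNgt -mu_prior//; apply/negP => muK.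
      by have := wmin (inl (inl tt)) muK.
    have jK : (H j <= K)%O.
      by case: (atomH j ALK) => // jK; move: w0; rewrite s_out// ltxx.
    by exists j => // E AE; rewrite Qw sm_in// (s_in K)// divr1.
  (* An atom is never first here: some [H i] below [K] charges it at rank 1. *)
  - have := wmin (inl (inr i)); rewrite /= s_in// => /(_ ltr01).
    by [].
exists Q; split => //.
- split=> [B ALB|F i AF].
    have AB := ALA ALB; have [_ prior1 _] := fa_prior.
    case: (QAL \top%O) => // [[_ Qmu]|[]]; last by rewrite prior1 ler10.
    by rewrite Qmu// prior1 meetx1 divr1 mu_prior.
  have ji j : (H j <= H i)%O -> j = i.
    move=> ji; apply: contrapT => /Hdisj; rewrite (meet_idPl ji); exact: H0.
  have ALHi : nonimpossible AL (H i) by split; [exact: ALH|exact: H0].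
  case: (QAL _ ALHi) => [[Hi ->//]|[_ [j /ji -> ->//]]].
  (* The only member of the partition below [H i] is itself, so both bounds can be
     [sigma F (H i)]. *)
  have : sigma F (H i) * prior (H i) <= mu (F `&` H i)%O <=
      sigma F (H i) * prior (H i).
    by apply: dis_mu => // j /ji ->; rewrite lexx.
  by move=> /le_anti <-; rewrite mulfK// gt_eqF.
- move=> F K B AF ALK ALB BK; have AB := ALA ALB.
  have AFB : A (F `&` B)%O by exact: AI.
  have [ALK' _] := ALK; set V := [set _ | _ in _].
  have FV : between H sigma F B (inf V) (sup V).
    move=> i iB; have Vi : V (sigma F (H i)) by exists i.
    rewrite ge_inf//=; last first.
      by exists 0 => _ [j _ <-]; case/andP: (sigma01 F j AF).
    by apply: ub_le_sup => //; exists 1 => _ [j _ <-]; case/andP: (sigma01 F j AF).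
  case: (QAL _ ALK) => [[K0 Qmu]|[_ [i iK Qs]]].
    rewrite !Qmu// -meetA (meet_idPl BK) mu_prior//.
    have /andP[l u] := dis_mu _ ALB _ _ _ AF FV.
    have scale x : prior B / prior K * x = x * prior B / prior K by ring.
    by rewrite !scale !ler_pM2r ?invr_gt0// l u.
  (* If [H i] implies [B], the middle term is [sigma F (H i)] and [B] has probability 1; otherwise
     all three terms are 0. *)
  rewrite !Qs//; case: (atomH i ALB) => iB.
    by rewrite (s_in B)// sm_in// !mul1r; exact: FV.
  by rewrite (s_out B)// sm_out// !mul0r lexx.
Qed.

End Existence.

(** * Non-emptiness and compactness *)

Unset Implicit Arguments.
Set Strict Implicit.

Theorem theorem8 (R : realType) (d : Order.disp_t) (T : ctbDistrLatticeType d)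
    (I J : Type) (H : I -> T) (E : J -> T)
    (hH : is_partition H) (hE : is_partition E)
    (AL AE A : set T)
    (hAL : boolean_subalgebra AL) (hAE : boolean_subalgebra AE)
    (hA : boolean_subalgebra A)
    (hAL1 : generated_algebra (range H) `<=` AL)
    (hAL2 : AL `<=` generated_complete_atomic (range H))
    (hAE1 : generated_algebra (range E) `<=` AE)
    (hAE2 : AE `<=` generated_complete_atomic (range E))
    (hA1 : generated_algebra (AL `|` AE) `<=` A)
    (hA2 : A `<=` generated_complete_atomic (AL `|` AE))
    (sigma : T -> T -> R) (hsigma : strategy A H sigma)
    (pi : T -> R) (hpi : fa_probability AL pi) :
  Qfsc A AL H pi sigma !=set0 /\ compact (Qfsc A AL H pi sigma).
Proof.
have ALA : AL `<=` A.
  by move=> x ALx; apply: hA1; apply: sub_generated_algebra; left.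
have ALH i : AL (H i).
  by apply: hAL1; apply: sub_generated_algebra; exists i.
have [_ Atop _ _ _] := hA.
(* Each event of [A] comes with its own least algebra; the one found for the top event contains all
   the others by their minimality. *)
have [C [catC GC _] _] := hA2 _ Atop.
have AC : A `<=` C.
  by move=> x /hA2[C' [_ _ minC'] C'x]; exact: (minC' C).
have atomH B i : AL B -> (H i <= B)%O \/ (H i `&` B)%O = \bot%O.
  by move=> /hAL2; exact: partition_generated_atom.
have [Q [Q1 Q2 Q3]] :=
  ex_conglomerable_fcp hA hAL ALA ALH hH AC catC atomH hsigma hpi.
have T0 := fa_top_neq_bot hAL hpi.
split; last first.
  apply: compact_Qfsc => // i; split; first exact/ALA/ALH.
  by case: hH => H0 _ _; exact: H0.
(* [Q] is known to take values in the unit interval only on the domain, so the point of the product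
   is built from these membership proofs. *)
have Q01 (F K : T) : F \in A -> K \in nonimpossible A ->
    Q F K \in (`[0, 1]%classic : set R).
  move=> /set_mem AF /set_mem AK; apply/mem_set.
  by have [c0 _ _ _] := Q1; rewrite /= in_itv/=; exact: c0.
exists (fun FK => exist _ (Q (val FK.1) (val FK.2))
  (Q01 _ _ (valP FK.1) (valP FK.2))).
by exists Q; split.
Qed.
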